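(* A graph $G=(V,E)$ is chordal if and only if $\mathcal{P}_{x,y}(G)$ equals the set of $(x,y)\in\mathbb{R}^V\times\mathbb{R}^E$ satisfying \begin{align*} y(\delta(v)) &\le x_v && \text{for all } v\in V,\\ -y_e &\le 0 && \text{for all } e\in E,\\ x(K)-y(E(K)) &\le 1 && \text{for all maximal cliques } K \text{ of } G. \end{align*}
   Context: All graphs are simple and connected. A graph is chordal if it contains no induced cycle (hole) of length at least 4. For $W\subseteq V$, $E(W)$ is the set of edges with both endpoints in $W$, $\delta(v)$ is the set of edges incident to $v$, and $x(A)=\sum_{a\in A}x_a$. A co-2-plex of $G$ is a set $S\subseteq V$ such that $G[S]$ has maximum degree at most 1. $\mathcal{P}_{x,y}(G)=\mathrm{conv}\{(\chi^S,\zeta^{E(S)}) : S \text{ co-2-plex of } G\}$, where $\chi^S\in\{0,1\}^V$, $\zeta^{F}\in\{0,1\}^E$ are incidence vectors. *)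

(* Defs.v *)
From HB Require Import structures.
From mathcomp Require Import all_boot all_order all_algebra.
From mathcomp Require Import reals.
Set Implicit Arguments. Unset Strict Implicit. Unset Printing Implicit Defensive.
Import Order.TTheory GRing.Theory Num.Theory.
Local Open Scope ring_scope.

Definition simple_graph (V : finType) (adj : rel V) : Prop :=
  symmetric adj /\ irreflexive adj.

Definition graph_connected (V : finType) (adj : rel V) : Prop :=
  forall u v : V, connect adj u v.

Definition is_edge (V : finType) (adj : rel V) (e : {set V}) : bool :=
  [exists u, exists v, adj u v && (e == [set u; v])].

Definition edge (V : finType) (adj : rel V) := {e : {set V} | is_edge adj e}.

Definition is_hole (V : finType) (adj : rel V) (k : nat) (c : 'I_k -> V) : Prop :=
  [/\ 4 <= k, injective c &
   forall i j : 'I_k,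
     adj (c i) (c j) = ((j == (i + 1) %% k :> nat) || (i == (j + 1) %% k :> nat))]%N.

Definition chordal (V : finType) (adj : rel V) : Prop :=
  ~ exists (k : nat) (c : 'I_k -> V), is_hole adj c.

Definition is_clique (V : finType) (adj : rel V) (K : {set V}) : Prop :=
  forall u v, u \in K -> v \in K -> u != v -> adj u v.

Definition maximal_clique (V : finType) (adj : rel V) (K : {set V}) : Prop :=
  is_clique adj K /\ (forall K', is_clique adj K' -> K \subset K' -> K' = K).

Definition co2plex (V : finType) (adj : rel V) (S : {set V}) : bool :=
  [forall v in S, #|[set u in S | adj v u]| <= 1]%N.

Definition chiv (R : realType) (V : finType) (S : {set V}) (v : V) : R :=
  (v \in S)%:R.
Definition zetav (R : realType) (V : finType) (adj : rel V) (S : {set V})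
  (e : edge adj) : R := (val e \subset S)%:R.

Definition in_Pxy (R : realType) (V : finType) (adj : rel V)
  (x : V -> R) (y : edge adj -> R) : Prop :=
  exists lam : {set V} -> R,
    [/\ forall S, co2plex adj S -> 0 <= lam S,
        \sum_(S | co2plex adj S) lam S = 1,
        forall v, x v = \sum_(S | co2plex adj S) lam S * chiv R S v &
        forall e, y e = \sum_(S | co2plex adj S) lam S * zetav R S e].

Definition in_system (R : realType) (V : finType) (adj : rel V)
  (x : V -> R) (y : edge adj -> R) : Prop :=
  [/\ forall v, \sum_(e : edge adj | v \in val e) y e <= x v,
      forall e, - y e <= 0 &
      forall K, maximal_clique adj K ->
        \sum_(v in K) x v - \sum_(e : edge adj | val e \subset K) y e <= 1].

(* Main.v *)
(** A chordal graph is built up by adding vertices [v] whose neighbours among the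
    earlier ones form a clique.  A point of the polyhedron is decomposed along this
    order: given a convex combination of co-2-plexes with the right marginals on
    the earlier vertices, a fraction of each co-2-plex [S] that misses the
    neighbourhood of [v], or meets it in a vertex isolated in [S], is replaced by
    [v |: S].  The star and clique inequalities say exactly that enough mass is
    available.  Conversely, a hole carries a half-integral point of the polyhedron
    that is excluded from the polytope by parity. *)
Require Import Defs.
From HB Require Import structures.
From mathcomp Require Import all_boot all_order all_algebra.
From mathcomp Require Import reals.
From mathcomp Require Import zify ring lra.
Import Order.TTheory GRing.Theory Num.Theory.
Set Implicit Arguments. Unset Strict Implicit. Unset Printing Implicit Defensive.
Local Open Scope ring_scope.

(** * Walks, induced paths and holes *)

(** Only interior vertices are confined to [D]: the ends used later lie on the boundary of a
    component, outside it. Values of [f] beyond [n] are irrelevant. *)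
Definition is_walk (V : finType) (adj : rel V) (D : {pred V}) (a b : V)
    (n : nat) (f : nat -> V) : Prop :=
  [/\ f 0%N = a, f n = b,
      forall i, (i < n)%N -> adj (f i) (f i.+1) &
      forall i, (0 < i < n)%N -> f i \in D].

Lemma walk_cut (V : finType) (adj : rel V) (D : {pred V}) (a b : V) (n : nat)
    (f : nat -> V) (i j : nat) :
  is_walk adj D a b n f -> (i.+1 < j <= n)%N -> adj (f i) (f j) ->
  exists m g, (m < n)%N /\ is_walk adj D a b m g.
Proof.
move=> [f0 fn fadj fD] ij aij.
exists (n - (j - i.+1))%N.
(* The new walk jumps along the chord from index [i] to [j], which drops the [j - i.+1] vertices
   strictly between. *)
exists (fun t => if (t <= i)%N then f t else f (t + (j - i.+1))%N).
split; first by lia.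
split=> [||t tn|t tn].
- by rewrite leq0n.
- by case: ifP => h; [exfalso; lia | rewrite subnK //; lia].
- case: ifP => h1; case: ifP => h2; try (exfalso; lia).
  + by apply: fadj; lia.
  + have -> : t = i by lia.
    by have -> : (i.+1 + (j - i.+1) = j)%N by lia.
  + by rewrite addSn; apply: fadj; lia.
- by case: ifP => h; apply: fD; lia.
Qed.

(* A shortest walk is an induced path: a repetition or a chord would allow a shortcut. *)
Lemma induced_walk (V : finType) (adj : rel V) (D : {pred V}) (a b : V)
    (n : nat) (f : nat -> V) :
  symmetric adj -> irreflexive adj -> is_walk adj D a b n f ->
  exists m g, [/\ is_walk adj D a b m g,
    forall i j, (i <= m)%N -> (j <= m)%N -> g i = g j -> i = j &
    forall i j, (i <= m)%N -> (j <= m)%N ->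
      adj (g i) (g j) = (j == i.+1) || (i == j.+1)].
Proof.
move=> adjC adjI; elim/ltn_ind: n f => n IHn f fw.
have [f0 fn fadj fD] := fw.
case: (boolP [exists i : 'I_n.+1, exists j : 'I_n.+1,
               (i < j)%N && ((f i == f j) || ((i.+1 < j)%N && adj (f i) (f j)))]).
  case/existsP=> i /existsP[j /andP[ij /orP[/eqP fij|/andP[ij1 aij]]]].
    (* A repetition [f i = f j] makes [f i] adjacent to [f j.+1], which is a shortcut; if [j = n]
       there is no successor and the walk is stopped at [i]. *)
    have [jn|jn] := ltnP j n.
      have [m [g [mn gw]]] : exists m g, (m < n)%N /\ is_walk adj D a b m g.
        apply: (walk_cut (i := i) (j := j.+1) fw); first by lia.
        by rewrite fij fadj.
      exact: (IHn m mn g).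
    have jE : (j : nat) = n by have := ltn_ord j; lia.
    apply: (IHn i _ f); first by lia.
    split=> // [|t ti|t ti]; first by rewrite fij jE.
      by apply: fadj; lia.
    by apply: fD; lia.
  have [m [g [mn gw]]] : exists m g, (m < n)%N /\ is_walk adj D a b m g.
    apply: (walk_cut (i := i) (j := j) fw) => //.
    by have := ltn_ord j; lia.
  exact: (IHn m mn g).
move=> noC.
have gen i j : (i < j)%N -> (j <= n)%N ->
    f i != f j /\ adj (f i) (f j) = (j == i.+1).
  move=> ij jn.
  have il : (i < n.+1)%N by lia.
  have jl : (j < n.+1)%N by lia.
  move: noC; rewrite negb_exists => /forallP/(_ (Ordinal il)).
  rewrite negb_exists => /forallP/(_ (Ordinal jl)) /=.
  rewrite ij /= negb_or => /andP[-> h]; split => //.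
  have [ij1|ij1] := ltnP i.+1 j.
    by move: h; rewrite ij1 /= => /negbTE ->; lia.
  have -> : j = i.+1 by lia.
  by rewrite eqxx fadj //; lia.
exists n, f; split=> // i j iN jN.
  move=> fij; case: (ltngtP i j) => // ij; exfalso.
    by have [/eqP nij _] := gen i j ij jN.
  by have [/eqP nij _] := gen j i ij iN; rewrite fij in nij.
case: (ltngtP i j) => ij.
- by have [_ ->] := gen i j ij jN; lia.
- by rewrite adjC; have [_ ->] := gen j i ij iN; lia.
- by rewrite ij adjI; lia.
Qed.

Lemma modn_succ (k i : nat) :
  (i < k)%N -> ((i + 1) %% k = if i.+1 == k then 0 else i.+1)%N.
Proof.
move=> ik; rewrite addn1; case: eqP => [->|h]; first by rewrite modnn.
by rewrite modn_small //; lia.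
Qed.

(** A shortest walk from [a] to [b] is closed up through [v]. Its interior avoids the neighbours of
    [v], so the cycle has no chord, and since [a] and [b] are distinct and not adjacent it has at
    least four vertices. *)
Lemma hole_of_walk (V : finType) (adj : rel V) (D : {pred V}) (v a b : V)
    (n : nat) (f : nat -> V) :
  symmetric adj -> irreflexive adj -> is_walk adj D a b n f ->
  adj v a -> adj v b -> a != b -> ~~ adj a b ->
  (forall u, u \in D -> (u != v) && ~~ adj v u) ->
  exists (k : nat) (c : 'I_k -> V), is_hole adj c.
Proof.
move=> adjC adjI fw va vb ab nab Dv.
have [m [g [[g0 gm gadj gD] ginj gE]]] := induced_walk adjC adjI fw.
have m2 : (2 <= m)%N.
  case: m gm gadj {gD ginj gE} => [|[|m]] // gm.
    by rewrite -gm -g0 eqxx in ab.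
  by move=> /(_ 0%N isT); rewrite g0 gm (negbTE nab).
have gv i : (i <= m)%N -> g i != v.
  move=> im; have [->|i0] := posnP i.
    by rewrite g0; apply: contraTneq va => ->; rewrite adjI.
  have [->|im'] := eqVneq i m.
    by rewrite gm; apply: contraTneq vb => ->; rewrite adjI.
  have /Dv/andP[] // : g i \in D by apply: gD; lia.
have va_g i : (i <= m)%N -> adj v (g i) = (i == 0%N) || (i == m).
  move=> im; have [->|i0] := posnP i; first by rewrite g0 va.
  have [->|im'] := eqVneq i m; first by rewrite gm vb orbT.
  have /Dv/andP[_ /negbTE ->] : g i \in D by apply: gD; lia.
  by lia.
(* The path occupies indices [0] to [m], and [v] sits at the last index [m.+1]. *)
exists m.+2, (fun i : 'I_m.+2 => if (i <= m)%N then g i else v).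
split; first by lia.
  move=> i j; have li := ltn_ord i; have lj := ltn_ord j.
  case: ifP => hi; case: ifP => hj h.
  - by apply/val_inj/ginj.
  - by have := gv i hi; rewrite h eqxx.
  - by have := gv j hj; rewrite h eqxx.
  - by apply/val_inj => /=; lia.
move=> i j; have li := ltn_ord i; have lj := ltn_ord j.
rewrite !modn_succ //.
case: (leqP i m) => hi; case: (leqP j m) => hj.
- rewrite gE //; do 2 case: ifP => ?; lia.
- rewrite adjC va_g //; do 2 case: ifP => ?; lia.
- rewrite va_g //; do 2 case: ifP => ?; lia.
- rewrite adjI; do 2 case: ifP => ?; lia.
Qed.

(** * Simplicial vertices of chordal graphs *)

Definition simplicial_in (V : finType) (adj : rel V) (W : {set V}) (v : V) : Prop :=
  is_clique adj [set u in W | adj v u].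

(* Dirac's argument.  Removing the closed neighbourhood of a well chosen vertex
   [v] leaves a component [C] whose boundary is a clique (a shortest path through
   [C] between two nonadjacent boundary vertices closes up with [v] to a hole),
   and the induction hypothesis applies to [C] together with its boundary. *)
Lemma chordal_simplicial (V : finType) (adj : rel V) (W Q : {set V}) :
  simple_graph adj -> chordal adj ->
  is_clique adj Q -> Q \proper W ->
  exists v, [/\ v \in W, v \notin Q & simplicial_in adj W v].
Proof.
move=> [adjC adjI] chG.
have [n] := ubnP #|W|; elim: n W Q => // n IHn W Q Wn clQ QW.
have [QsW [q qW qQ]] := properP QW.
case: (boolP [forall u in W, forall w in W, (u != w) ==> adj u w]).
  move=> /forall_inP clW; exists q; split=> // u w.
  rewrite !inE => /andP[uW _] /andP[wW _] uw.
  by have /forall_inP/(_ w wW)/implyP/(_ uw) := clW u uW.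
move=> ncl.
pose nonuniv v := [exists w in W, (v != w) && ~~ adj v w].
(* A non-universal vertex of the clique [Q] serves if there is one; otherwise every vertex of [Q] is
   adjacent to all others in [W], and any non-universal vertex serves. *)
have [v [vW vnu Qv]] : exists v, [/\ v \in W, nonuniv v &
    forall u, u \in Q -> (u == v) || adj v u].
  case: (boolP [exists v in Q, nonuniv v]).
    move=> /exists_inP[v vQ nv]; exists v; split=> //.
      exact: (subsetP QsW).
    by move=> u uQ; case: eqVneq => //= uv; apply: clQ; rewrite // eq_sym.
  move=> nQ; move: ncl; rewrite negb_forall => /existsP[v].
  rewrite negb_imply => /andP[vW]; rewrite negb_forall => /existsP[w].
  rewrite !negb_imply => /andP[wW vw]; exists v; split=> //.
    by apply/exists_inP; exists w.
  move=> u uQ; case: eqVneq => //= uv.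
  move: nQ; rewrite negb_exists => /forallP/(_ u); rewrite uQ /=.
  rewrite negb_exists => /forallP/(_ v); rewrite vW uv /= negbK.
  by rewrite adjC.
have [u0 u0W /andP[vu0 nvu0]] := exists_inP vnu.
pose D := [set u in W | (u != v) && ~~ adj v u].
pose r := [rel a b | [&& adj a b, a \in D & b \in D]].
have rC : connect_sym r.
  by apply: sym_connect_sym => a b /=; rewrite adjC andbA andbAC -andbA.
pose C := [set u | connect r u0 u].
have u0D : u0 \in D by rewrite inE u0W eq_sym vu0.
have CD u : u \in C -> u \in D.
  rewrite inE => /connectP[p]; elim/last_ind: p => [|p z _] /=; first by move=> _ ->.
  by rewrite rcons_path last_rcons => /andP[_ /and3P[_ _ zD]] ->.
have Cadj u w : u \in C -> adj u w -> w \in D -> w \in C.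
  move=> uC uw wD; have uD := CD u uC; move: uC; rewrite !inE => uC.
  by apply: connect_trans uC (connect1 _); rewrite /= uw uD wD.
pose B := [set w in W :\: D | [exists u in C, adj u w]].
have Bv w : w \in B -> adj v w.
  rewrite !inE => /andP[/andP[h wW] /exists_inP[u uC uw]].
  move: h; rewrite wW /= negb_and !negbK => /orP[/eqP wv|//].
  by have := CD u uC; rewrite !inE -wv (adjC w) uw !andbF.
have clB : is_clique adj B.
  move=> a b aB bB ab; apply/negPn/negP => nab; apply: chG.
  have [c1 c1C c1a] : exists2 c, c \in C & adj c a.
    by apply/exists_inP; move: aB; rewrite inE => /andP[].
  have [c2 c2C c2b] : exists2 c, c \in C & adj c b.
    by apply/exists_inP; move: bB; rewrite inE => /andP[].
  have /connectP[p pp c2E] : connect r c1 c2.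
    rewrite !inE in c1C c2C.
    by apply: connect_trans c2C; rewrite rC.
  have sp i : (i <= size p)%N -> nth c1 (c1 :: p) i \in D.
    elim: i => [|i IHi] ip; first exact: CD.
    by have /(pathP c1)/(_ i ip) /and3P[] := pp.
  (* The list [a :: c1 :: p] omits [b]: the default value of [nth] supplies it at the final index
     [(size p).+2]. *)
  apply: (@hole_of_walk V adj [in D] v a b (size p).+2
    (fun i => nth b (a :: c1 :: p) i)) => //; last 3 first.
  - exact: Bv.
  - exact: Bv.
  - by move=> u; rewrite !inE => /andP[_ ->].
  split=> //.
  - by rewrite nth_default.
  - move=> [|i] ip /=; first by rewrite adjC.
    have [ip'|ip'] := ltnP i (size p).
      have /(pathP b)/(_ i ip') /= /and3P[] // := pp.
    have -> : i = size p by apply/eqP; rewrite eqn_leq ip' andbT.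
    rewrite [X in adj _ X]nth_default // (_ : nth b _ _ = c2) //.
    by rewrite c2E (last_nth b).
  - by move=> [|i] //= ip; rewrite (set_nth_default c1) //; apply: sp.
have vCB : v \notin C :|: B.
  rewrite inE negb_or; apply/andP; split.
    by apply/negP => /CD; rewrite inE eqxx andbF.
  by apply/negP => /Bv; rewrite adjI.
have CBW : C :|: B \subset W.
  apply/subsetP => u; rewrite inE => /orP[/CD|]; first by rewrite inE => /andP[].
  by rewrite !inE => /andP[/andP[]].
(* The set [C :|: B] is smaller than [W] because it misses [v]. The vertex [s] obtained avoids [B],
   so it lies in [C]; hence it is outside [Q], and all its neighbours in [W] stay in [C :|: B]. *)
have [] := IHn (C :|: B) B.
- rewrite -ltnS; apply: leq_trans Wn; rewrite ltnS; apply: proper_card.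
  by apply/properP; split=> //; exists v.
- exact: clB.
- apply/properP; split; first exact: subsetUr.
  by exists u0; [rewrite !inE connect0 | rewrite inE in_setD u0D].
move=> s [sCB sB sS].
have sC : s \in C by move: sCB; rewrite inE (negbTE sB) orbF.
have sD := CD s sC.
exists s; split; first exact: (subsetP CBW).
  by apply/negP => /Qv; move: sD; rewrite inE => /andP[_ /andP[/negbTE -> /negbTE ->]].
have NS u : u \in W -> adj s u -> u \in C :|: B.
  move=> uW su; rewrite in_setU; case: (boolP (u \in D)) => uD.
    by rewrite (Cadj s u).
  rewrite [u \in B]inE in_setD uD uW /=.
  by apply/orP; right; apply/exists_inP; exists s.
move=> a b; rewrite !in_set => /andP[aW sa] /andP[bW sb].
by apply: sS; rewrite in_set ?sa ?sb NS.
Qed.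

(** * Sums over edges *)

Lemma is_edgeP (V : finType) (adj : rel V) (A : {set V}) :
  reflect (exists u v, adj u v /\ A = [set u; v]) (is_edge adj A).
Proof.
apply: (iffP existsP) => [[u /existsP[v /andP[uv /eqP ->]]]|[u [v [uv ->]]]].
  by exists u, v.
by exists u; apply/existsP; exists v; rewrite uv /=.
Qed.

Lemma card_edge (V : finType) (adj : rel V) (A : {set V}) :
  irreflexive adj -> is_edge adj A -> #|A| = 2%N.
Proof.
move=> adjI /is_edgeP[u [v [uv ->]]]; rewrite cards2.
by case: eqVneq uv => // ->; rewrite adjI.
Qed.

Lemma sum_edge_type (R : realType) (V : finType) (adj : rel V) (P : pred {set V})
    (F : {set V} -> R) :
  \sum_(e : edge adj | P (val e)) F (val e) =
  \sum_(A | is_edge adj A && P A) F A.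
Proof. by apply/esym; exact: (big_sub_cond (is_edge adj) P F). Qed.

(** Extension by zero lets edge weights be evaluated at sets such as [[set v; u]] without carrying a
    proof that they are edges. *)
Definition extend_edge (R : realType) (V : finType) (adj : rel V)
  (y : edge adj -> R) (A : {set V}) : R := oapp y 0 (insub A).

Lemma extend_edgeK (R : realType) (V : finType) (adj : rel V)
    (y : edge adj -> R) (e : edge adj) : extend_edge y (val e) = y e.
Proof. by rewrite /extend_edge valK. Qed.

Lemma sum_extend_edge (R : realType) (V : finType) (adj : rel V)
    (y : edge adj -> R) (P : pred {set V}) :
  \sum_(e : edge adj | P (val e)) y e =
  \sum_(A | is_edge adj A && P A) extend_edge y A.
Proof.
by rewrite -sum_edge_type; apply: eq_bigr => e _; rewrite extend_edgeK.
Qed.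

Lemma sum_edge_at (R : realType) (V : finType) (adj : rel V) (v : V)
    (F : {set V} -> R) :
  simple_graph adj ->
  \sum_(A | is_edge adj A && (v \in A)) F A = \sum_(u | adj v u) F [set v; u].
Proof.
move=> [adjC adjI].
rewrite -[RHS]big_set -(@big_imset _ _ _ _ _ (fun u => [set v; u]) [set u | adj v u]) /=.
  apply: eq_bigl => A; apply/andP/imsetP => [[/is_edgeP[u [w [uw ->]]]]|].
    rewrite !inE => /orP[]/eqP ->; first by exists w; rewrite ?inE.
    by exists u; rewrite ?inE 1?adjC // setUC.
  move=> [u]; rewrite inE => vu ->; rewrite !inE eqxx; split=> //.
  by apply/is_edgeP; exists v, u.
move=> u w; rewrite !inE => vu vw /setP/(_ u); rewrite !inE eqxx orbT.
by move/esym/orP=> [/eqP uv|/eqP //]; rewrite uv adjI in vu.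
Qed.

Lemma sum_edgeU1 (R : realType) (V : finType) (adj : rel V) (v : V) (K : {set V})
    (F : {set V} -> R) :
  simple_graph adj -> v \notin K ->
  \sum_(A | is_edge adj A && (A \subset v |: K)) F A =
  \sum_(A | is_edge adj A && (A \subset K)) F A +
  \sum_(u in K | adj v u) F [set v; u].
Proof.
move=> G vK; rewrite (bigID (fun A : {set V} => v \in A)) [RHS]addrC /=; congr (_ + _); last first.
  apply: eq_bigl => A; rewrite -andbA; congr (_ && _).
  by rewrite -subsetD1 setU1K.
under eq_bigl do rewrite andbAC.
rewrite big_mkcondr sum_edge_at //.
rewrite [RHS]big_mkcond [LHS]big_mkcond /=; apply: eq_bigr => u _.
rewrite subUset !sub1set !inE eqxx /= andbC; case: (boolP (adj v u)) => //= vu.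
by case: eqVneq vu => //= ->; rewrite G.2.
Qed.

(** * Co-2-plexes satisfy the inequalities *)

Definition isolated_in (V : finType) (adj : rel V) (S : {set V}) (w : V) : bool :=
  (w \in S) && [forall u in S, ~~ adj w u].

(** For [w] in [S] the sum is the degree of [w] in [S], which is 0 or 1. This identifies the slack
    of the star inequality at [w]. *)
Lemma co2plex_isolated (R : realType) (V : finType) (adj : rel V) (S : {set V})
    (w : V) :
  simple_graph adj -> co2plex adj S ->
  (isolated_in adj S w)%:R =
  (w \in S)%:R - \sum_(A | is_edge adj A && (w \in A)) (A \subset S)%:R :> R.
Proof.
move=> G /forall_inP coS; rewrite sum_edge_at // /isolated_in.
case: (boolP (w \in S)) => wS /=; last first.
  by rewrite big1 ?subrr // => u _; rewrite subUset sub1set (negbTE wS).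
have -> : \sum_(u | adj w u) ([set w; u] \subset S)%:R =
    #|[set u in S | adj w u]|%:R :> R.
  rewrite -sum1_card natr_sum big_mkcond [RHS]big_mkcond /=.
  apply: eq_bigr => u _; rewrite subUset !sub1set wS !inE andbC /=.
  by case: (adj w u) => //=; case: (u \in S).
case: (boolP [forall u in S, ~~ adj w u]) => [/forall_inP isoS|].
  rewrite (_ : [set u in S | adj w u] = set0) ?cards0 ?subr0 //.
  by apply/setP => u; rewrite !inE; apply/andP => -[/isoS/negbTE ->].
rewrite negb_forall => /existsP[u]; rewrite negb_imply negbK => /andP[uS wu].
have : (0 < #|[set u in S | adj w u]|)%N by apply/card_gt0P; exists u; rewrite inE uS.
by have := coS w wS; case: #|_| => [|[|]] // _ _; rewrite subrr.
Qed.

(* A co-2-plex meets a clique in at most two vertices. *)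
Lemma co2plex_meets_clique (R : realType) (V : finType) (adj : rel V)
    (S K : {set V}) :
  simple_graph adj -> co2plex adj S -> is_clique adj K ->
  \sum_(v in K) (v \in S)%:R -
  \sum_(A | is_edge adj A && (A \subset K)) (A \subset S)%:R =
  (S :&: K != set0)%:R :> R.
Proof.
move=> G /forall_inP coS clK; set T := S :&: K.
have T2 : (#|T| <= 2)%N.
  have [->|/set0Pn[t tT]] := eqVneq T set0; first by rewrite cards0.
  rewrite (cardsD1 t) tT add1n ltnS.
  move: (tT); rewrite inE => /andP[tS tK].
  apply: leq_trans (coS t tS); apply: subset_leq_card; apply/subsetP => u.
  by rewrite !inE => /and3P[ut uS uK]; rewrite uS clK // eq_sym.
have -> : \sum_(v in K) (v \in S)%:R = #|T|%:R :> R.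
  rewrite -sum1_card natr_sum big_mkcond [RHS]big_mkcond /=.
  apply: eq_bigr => u _; rewrite inE.
  by case: (u \in K); case: (u \in S).
have -> : \sum_(A | is_edge adj A && (A \subset K)) (A \subset S)%:R =
    (#|T| == 2)%N%:R :> R.
  (* An edge has two elements and [T] at most two, so the only edge that [T] can contain is [T]
     itself. *)
  have TE A : is_edge adj A -> A \subset T -> A = T.
    move=> /(card_edge G.2) cA AT; apply/eqP; rewrite eqEcard AT cA; exact: T2.
  transitivity (\sum_(A | is_edge adj A && (A \subset T)) 1 : R).
    rewrite big_mkcond [RHS]big_mkcond; apply: eq_bigr => A _ /=.
    by rewrite subsetI; case: (is_edge adj A); case: (A \subset K); case: (A \subset S).
  have [cT|cT] := eqVneq #|T| 2%N; last first.
    rewrite big1 // => A /andP[eA AT]; case/eqP: cT.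
    by rewrite -(TE A) // (card_edge G.2).
  rewrite (big_pred1 T) // => A /=; apply/andP/eqP => [[] /TE //|->].
  split=> //.
  have /cards2P[u [w [uw Tuw]]] : #|T| == 2%N by rewrite cT.
  apply/is_edgeP; exists u, w; split=> //.
  have inT z : z \in T -> z \in K by rewrite inE => /andP[].
  by apply: clK => //; apply: inT; rewrite Tuw !inE eqxx ?orbT.
rewrite -cards_eq0; case: #|T| T2 => [|[|[|]]] //= _; rewrite ?subr0 //.
by rewrite -[1%:R]/1; lra.
Qed.

Lemma sum_edge_Pxy (R : realType) (V : finType) (adj : rel V) (lam : {set V} -> R)
    (y : edge adj -> R) (P : pred {set V}) :
  (forall e, y e = \sum_(S | co2plex adj S) lam S * zetav R S e) ->
  \sum_(e : edge adj | P (val e)) y e =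
  \sum_(S | co2plex adj S)
    lam S * \sum_(A | is_edge adj A && P A) (A \subset S)%:R.
Proof.
move=> yE; under eq_bigr do rewrite yE.
rewrite exchange_big; apply: eq_bigr => S _ /=; rewrite -mulr_sumr.
by rewrite -(sum_edge_type adj P (fun A => (A \subset S)%:R)).
Qed.

(** The inequalities are checked on each co-2-plex [S] and averaged: the star slack is the indicator
    that [v] is isolated in [S], and the clique left-hand side is the indicator that [S] meets
    [K]. *)
Lemma Pxy_system (R : realType) (V : finType) (adj : rel V) (x : V -> R)
    (y : edge adj -> R) : simple_graph adj -> in_Pxy x y -> in_system x y.
Proof.
move=> G [lam [lam0 lam1 xE yE]]; split=> [v|e|K [clK _]].
- rewrite (sum_edge_Pxy (fun A => v \in A) yE) xE; apply: ler_sum => S coS.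
  apply: ler_wpM2l; first exact: lam0.
  by rewrite -subr_ge0 /chiv -co2plex_isolated.
- rewrite oppr_le0 yE; apply: sumr_ge0 => S coS.
  by apply: mulr_ge0; [exact: lam0 | exact: ler0n].
- rewrite (sum_edge_Pxy (fun A => A \subset K) yE).
  under eq_bigr do rewrite xE.
  rewrite exchange_big -sumrB -[leRHS]lam1; apply: ler_sum => S coS /=.
  rewrite -mulr_sumr -mulrBr /chiv co2plex_meets_clique //.
  by apply: ler_piMr; [exact: lam0 | rewrite lern1 leq_b1].
Qed.

(** * Decomposition of a feasible point along simplicial vertices *)

(** All cliques are bounded, since the cliques formed by a simplicial vertex and its earlier
    neighbours need not be maximal. *)
Definition edge_feasible (R : realType) (V : finType) (adj : rel V) (x : V -> R)
    (w : {set V} -> R) : Prop :=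
  [/\ forall A, is_edge adj A -> 0 <= w A,
      forall v, \sum_(A | is_edge adj A && (v \in A)) w A <= x v &
      forall K, is_clique adj K ->
        \sum_(v in K) x v - \sum_(A | is_edge adj A && (A \subset K)) w A <= 1].

Lemma edge_sum_in_le (R : realType) (V : finType) (adj : rel V) (w : {set V} -> R)
    (v : V) (K : {set V}) :
  simple_graph adj -> (forall A, is_edge adj A -> 0 <= w A) ->
  \sum_(u in K | adj v u) w [set v; u] <=
  \sum_(A | is_edge adj A && (v \in A)) w A.
Proof.
move=> G w0; rewrite sum_edge_at // [leRHS](bigID (mem K)) /=.
rewrite (eq_bigl (fun u => adj v u && (u \in K))) => [|u]; last by rewrite andbC.
rewrite lerDl; apply: sumr_ge0 => u /andP[vu _].
by apply: w0; apply/is_edgeP; exists v, u.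
Qed.

(* Adding a vertex [v] to [K] increases [x(K) - y(E(K))] by at least
   [x_v - y(delta(v)) >= 0], so it suffices to bound maximal cliques. *)
Lemma system_feasible (R : realType) (V : finType) (adj : rel V) (x : V -> R)
    (y : edge adj -> R) :
  simple_graph adj -> in_system x y -> edge_feasible adj x (extend_edge y).
Proof.
move=> G [yx y0 yK].
have w0 A : is_edge adj A -> 0 <= extend_edge y A.
  by move=> eA; have := y0 (Sub A eA); rewrite oppr_le0 -(extend_edgeK y) SubK.
have wx v : \sum_(A | is_edge adj A && (v \in A)) extend_edge y A <= x v.
  by rewrite -(sum_extend_edge y (fun A => v \in A)).
split=> // K; have [n] := ubnP #|~: K|.
elim: n K => // n IHn K Kn clK.
case: (boolP [exists v, (v \notin K) && [forall u in K, adj v u]]).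
  move=> /existsP[v /andP[vK /forall_inP vadj]].
  have clvK : is_clique adj (v |: K).
    move=> a b; rewrite !inE => /orP[/eqP ->|aK] /orP[/eqP ->|bK] ab.
    - by rewrite eqxx in ab.
    - exact: vadj.
    - by rewrite G.1; apply: vadj.
    - exact: clK.
  have lt_vK : (#|~: (v |: K)| < n)%N.
    rewrite -ltnS; apply: leq_trans Kn; rewrite ltnS; apply: proper_card.
    by rewrite properC; apply: properUr; rewrite sub1set.
  have := IHn _ lt_vK clvK; rewrite big_setU1 //= sum_edgeU1 //.
  by have := edge_sum_in_le v K G w0; have := wx v; lra.
move=> noext; rewrite -(sum_extend_edge y (fun A => A \subset K)).
apply: yK; split=> // K' clK' KK'; apply/eqP; rewrite eqEsubset KK' andbT.
apply/subsetP => v vK'; apply: contraNT noext => vK; apply/existsP; exists v.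
rewrite vK; apply/forall_inP => u uK; apply: clK' => //.
  exact: (subsetP KK').
by apply: contraNneq vK => ->.
Qed.

Definition decomposes_on (R : realType) (V : finType) (adj : rel V) (x : V -> R)
    (w : {set V} -> R) (W : {set V}) (lam : {set V} -> R) : Prop :=
  [/\ forall S, 0 <= lam S,
      forall S, lam S != 0 -> co2plex adj S && (S \subset W),
      \sum_S lam S = 1,
      forall v, v \in W -> \sum_S lam S * (v \in S)%:R = x v &
      forall A, is_edge adj A -> A \subset W ->
        \sum_S lam S * (A \subset S)%:R = w A].

(** Only neighbours of [v] gain degree, and they had degree zero in [S]. *)
Lemma co2plexU1 (V : finType) (adj : rel V) (S : {set V}) (v : V) :
  simple_graph adj -> co2plex adj S ->
  (#|[set u in S | adj v u]| <= 1)%N ->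
  (forall u, u \in S -> adj v u -> isolated_in adj S u) ->
  co2plex adj (v |: S).
Proof.
move=> G /forall_inP coS deg_v iso; apply/forall_inP => u.
rewrite !inE => /orP[/eqP ->|uS].
  apply: leq_trans deg_v; apply: subset_leq_card; apply/subsetP => t.
  by rewrite !inE => /andP[/orP[/eqP ->|->] //]; rewrite G.2.
case: (boolP (adj v u)) => vu.
  have /andP[_ /forall_inP uiso] := iso u uS vu.
  rewrite -(cards1 v); apply: subset_leq_card; apply/subsetP => t.
  by rewrite !inE => /andP[/orP[//|/uiso/negbTE ->]].
apply: leq_trans (coS u uS); apply: subset_leq_card; apply/subsetP => t.
by rewrite !inE => /andP[/orP[/eqP ->|->] //]; rewrite G.1 (negbTE vu).
Qed.

(* Each set [S] of the old decomposition is split into [S] and [v |: S] in the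
   proportion [1 - p S : p S]. *)
Lemma sum_split_at (R : realType) (V : finType) (v : V) (p lam f : {set V} -> R) :
  \sum_T (\sum_S lam S * ((1 - p S) * (T == S)%:R + p S * (T == v |: S)%:R)) * f T =
  \sum_S lam S * ((1 - p S) * f S + p S * f (v |: S)).
Proof.
under eq_bigr do rewrite mulr_suml.
rewrite exchange_big; apply: eq_bigr => S _ /=.
under eq_bigr do rewrite -mulrA mulrDl.
rewrite -mulr_sumr big_split /=; congr (_ * (_ + _)).
  rewrite (bigD1 S) //= eqxx big1 ?addr0 ?mulr1 // => T /negbTE ->.
  by rewrite mulr0 mul0r.
rewrite (bigD1 (v |: S)) //= eqxx big1 ?addr0 ?mulr1 // => T /negbTE ->.
by rewrite mulr0 mul0r.
Qed.

(** Splitting preserves the mean of any function that ignores [v], so only the marginals of [v] and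
    of the edges at [v] remain, and these are prescribed by the last two hypotheses on [p]. *)
Lemma decomposes_split (R : realType) (V : finType) (adj : rel V) (x : V -> R)
    (w : {set V} -> R) (W : {set V}) (v : V) (lam p : {set V} -> R) :
  simple_graph adj -> v \notin W -> decomposes_on adj x w W lam ->
  (forall S, lam S != 0 -> 0 <= p S <= 1) ->
  (forall S, lam S != 0 -> p S != 0 -> co2plex adj (v |: S)) ->
  \sum_S lam S * p S = x v ->
  (forall u, u \in W -> adj v u ->
    \sum_S lam S * (p S * (u \in S)%:R) = w [set v; u]) ->
  exists lam', decomposes_on adj x w (v |: W) lam'.
Proof.
move=> G vW [lam0 lamS lam1 lamx lamw] p01 pco pv pu.
pose lam' (T : {set V}) := \sum_S lam S * ((1 - p S) * (T == S)%:R + p S * (T == v |: S)%:R).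
have sumE f : \sum_T lam' T * f T = \sum_S lam S * ((1 - p S) * f S + p S * f (v |: S)).
  exact: sum_split_at.
have inv (f : {set V} -> R) : (forall S : {set V}, S \subset W -> f (v |: S) = f S) ->
    \sum_T lam' T * f T = \sum_S lam S * f S.
  move=> fv; rewrite sumE; apply: eq_bigr => S _.
  have [->|/lamS/andP[_ SW]] := eqVneq (lam S) 0; first by rewrite !mul0r.
  by rewrite fv //; ring.
have vS S : lam S != 0 -> (v \in S) = false.
  by move=> /lamS/andP[_ SW]; apply: contraNF vW; apply: (subsetP SW).
exists lam'; split=> [T|T|||].
- apply: sumr_ge0 => S _.
  have [->|lS] := eqVneq (lam S) 0; first by rewrite mul0r.
  have /andP[p0 p1] := p01 S lS.
  by rewrite mulr_ge0 // addr_ge0 // mulr_ge0 // subr_ge0.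
- move=> lT; apply: contraNT lT => nT; apply/eqP; apply: big1 => S _.
  have [->|lS] := eqVneq (lam S) 0; first by rewrite mul0r.
  have /andP[coS SW] := lamS S lS.
  case: (T =P S) nT => [->|_]; first by rewrite coS subsetU ?SW ?orbT.
  case: (T =P v |: S) => [->|_ _]; last by rewrite !mulr0 addr0 mulr0.
  rewrite setUS // andbT => nco; have [->|/(pco S lS) co] := eqVneq (p S) 0.
    by rewrite mulr0 mul0r addr0 mulr0.
  by rewrite co in nco.
- transitivity (\sum_T lam' T * 1); first by apply: eq_bigr => T _; rewrite mulr1.
  by rewrite inv // -[RHS]lam1; apply: eq_bigr => T _; rewrite mulr1.
- move=> u; rewrite in_setU1; case: eqVneq => [-> _|uv /= uW].
    rewrite sumE -pv; apply: eq_bigr => S _.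
    have [->|/vS ->] := eqVneq (lam S) 0; first by rewrite !mul0r.
    by rewrite setU11 mulr0 add0r mulr1.
  rewrite -lamx //; apply: inv => S _.
  by rewrite in_setU1 (negbTE uv).
- move=> A eA AW; case: (boolP (v \in A)) => vA; last first.
    have AW' : A \subset W by rewrite -(setU1K vW) subsetD1 AW.
    rewrite -lamw //; apply: inv => S SW; congr (_%:R).
    by rewrite -[in RHS](setU1K (contra (subsetP SW v) vW)) subsetD1 vA andbT.
  have [u uA] : exists u, adj v u /\ A = [set v; u].
    move/is_edgeP: eA => [a [b [ab AE]]]; move: vA; rewrite AE !inE.
    by case/orP=> /eqP ->; [exists b | exists a; rewrite G.1 setUC].
  case: uA => vu AE.
  have uv : u != v by apply: contraTneq vu => ->; rewrite G.2.
  have uW : u \in W.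
    by move: AW; rewrite AE subUset !sub1set !in_setU1 (negbTE uv) => /andP[].
  rewrite AE -pu // sumE; apply: eq_bigr => S _.
  have [->|/vS vS'] := eqVneq (lam S) 0; first by rewrite !mul0r.
  by rewrite !subUset !sub1set !in_setU1 vS' eqxx (negbTE uv) mulr0 add0r.
Qed.

(* The mass available for [v] alone is that of the sets missing the clique [K] of
   neighbours of [v], and the mass available for the edge [v u] is that of the sets
   in which [u] is isolated; distribute [x_v - y(K, v)] and [y_vu] proportionally. *)
Lemma decomposes_simplicial (R : realType) (V : finType) (adj : rel V) (x : V -> R)
    (w : {set V} -> R) (W : {set V}) (v : V) (lam : {set V} -> R) :
  simple_graph adj -> edge_feasible adj x w -> v \notin W ->
  simplicial_in adj W v -> decomposes_on adj x w W lam ->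
  exists lam', decomposes_on adj x w (v |: W) lam'.
Proof.
move=> G [w0 wx wK] vW; rewrite /simplicial_in; set K := [set u in W | adj v u].
move=> clK dec; have [lam0 lamS lam1 lamx lamw] := dec.
have KW u : u \in K -> u \in W by rewrite inE => /andP[].
have Kv u : u \in K -> adj v u by rewrite inE => /andP[].
have w0K u : u \in K -> 0 <= w [set v; u].
  by move=> /Kv vu; apply: w0; apply/is_edgeP; exists v, u.
have lam_out (A : {set V}) : v \in A -> \sum_S lam S * (A \subset S)%:R = 0.
  move=> vA; apply: big1 => S _.
  have [->|/lamS/andP[_ SW]] := eqVneq (lam S) 0; first by rewrite mul0r.
  rewrite (_ : A \subset S = false) ?mulr0 //.
  by apply: contraNF vW => AS; apply: (subsetP SW); apply: (subsetP AS).
pose m u := \sum_S lam S * (isolated_in adj S u)%:R.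
pose m0 := \sum_S lam S * (S :&: K == set0)%:R.
pose z := x v - \sum_(u in K) w [set v; u].
(* Here [m u] is [x u] minus the mass already on edges at [u]. The edge [[set v; u]] has no mass yet
   and every other edge at [u] has at most its weight, so the star inequality at [u] leaves room for
   [w [set v; u]]. *)
have hm u : u \in K -> 0 <= w [set v; u] <= m u.
  move=> uK; rewrite w0K //=.
  have -> : m u = x u -
      \sum_(A | is_edge adj A && (u \in A)) \sum_S lam S * (A \subset S)%:R.
    rewrite exchange_big -lamx ?KW // -sumrB; apply: eq_bigr => S _ /=.
    have [->|/lamS/andP[coS _]] := eqVneq (lam S) 0.
      by rewrite big1 ?mul0r ?subrr // => A _; rewrite mul0r.
    by rewrite co2plex_isolated // mulrBr mulr_sumr.
  have evu : is_edge adj [set v; u] && (u \in [set v; u]).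
    rewrite !inE eqxx orbT andbT; apply/is_edgeP; exists v, u.
    by split=> //; apply: Kv.
  have := wx u; rewrite (bigD1 [set v; u]) //= => wxu.
  rewrite [X in _ - X](bigD1 [set v; u]) //= lam_out ?set21 // add0r.
  have : \sum_(A | is_edge adj A && (u \in A) && (A != [set v; u]))
             \sum_S lam S * (A \subset S)%:R <=
         \sum_(A | is_edge adj A && (u \in A) && (A != [set v; u])) w A.
    apply: ler_sum => A /andP[/andP[eA uA] Avu].
    case: (boolP (A \subset W)) => AW; first by rewrite lamw.
    rewrite [leLHS]big1 ?w0 // => S _.
    have [->|/lamS/andP[_ SW]] := eqVneq (lam S) 0; first by rewrite mul0r.
    rewrite (_ : A \subset S = false) ?mulr0 //.
    by apply: contraNF AW => AS; apply: subset_trans SW.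
  by lra.
(* The lower bound is the star inequality at [v], the upper bound the inequality of the clique
   [v |: K]. *)
have hz : 0 <= z <= m0.
  have KE (F : {set V} -> R) :
      \sum_(u in K | adj v u) F [set v; u] = \sum_(u in K) F [set v; u].
    by apply: eq_bigl => u; case: (boolP (u \in K)) => //= /Kv ->.
  apply/andP; split.
    rewrite subr_ge0 -KE; apply: le_trans (wx v); exact: edge_sum_in_le.
  have -> : m0 = 1 -
      (\sum_(u in K) x u - \sum_(A | is_edge adj A && (A \subset K)) w A).
    have -> : \sum_(u in K) x u = \sum_(u in K) \sum_S lam S * (u \in S)%:R.
      by apply: eq_bigr => u uK; rewrite lamx ?KW.
    have -> : \sum_(A | is_edge adj A && (A \subset K)) w A =
        \sum_(A | is_edge adj A && (A \subset K)) \sum_S lam S * (A \subset S)%:R.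
      apply: eq_bigr => A /andP[eA AK]; rewrite lamw //.
      by apply: subset_trans AK _; apply/subsetP.
    rewrite exchange_big [X in _ - (_ - X)]exchange_big /= -!sumrB -[X in X - _]lam1 -sumrB.
    apply: eq_bigr => S _ /=; rewrite -!mulr_sumr.
    have [->|/lamS/andP[coS _]] := eqVneq (lam S) 0.
      by rewrite !mul0r !subr0.
    rewrite -mulrBr co2plex_meets_clique //.
    by case: eqP => _ /=; rewrite ?mulr1 ?mulr0 ?subr0 ?subrr.
  have vK : v \notin K by apply: contra vW; apply: KW.
  have clvK : is_clique adj (v |: K).
    move=> a b; rewrite !in_setU1 => /orP[/eqP ->|aK] /orP[/eqP ->|bK] ab.
    - by rewrite eqxx in ab.
    - exact: Kv.
    - by rewrite G.1; apply: Kv.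
    - exact: clK.
  by have := wK _ clvK; rewrite big_setU1 //= sum_edgeU1 // KE /z; lra.
pose p S := (S :&: K == set0)%:R * (z / m0) +
  \sum_(u in K) (isolated_in adj S u)%:R * (w [set v; u] / m u).
(* If the available mass [b] is zero then so is [a], which agrees with the convention that division
   by zero gives zero. *)
have divK (a b : R) : 0 <= a <= b -> b * (a / b) = a.
  move=> /andP[a0 ab]; have [b0|b0] := eqVneq b 0; last by rewrite mulrC divfK.
  by rewrite b0 mul0r; apply: le_anti; rewrite a0 -b0 ab.
have div01 (a b : R) : 0 <= a <= b -> 0 <= a / b <= 1.
  move=> /andP[a0 ab]; have [b0|b0] := eqVneq b 0; first by rewrite b0 invr0 mulr0 lexx ler01.
  have bp : 0 < b by rewrite lt_neqAle eq_sym b0 (le_trans a0).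
  by rewrite divr_ge0 ?(ltW bp) //= ler_pdivrMr // mul1r.
have pE0 (S : {set V}) : S :&: K = set0 -> p S = z / m0.
  move=> SK; rewrite /p SK eqxx mul1r big1 ?addr0 // => u uK.
  rewrite (_ : isolated_in adj S u = false) ?mul0r //.
  apply/negP => /andP[uS _]; have : u \in S :&: K by rewrite inE uS.
  by rewrite SK inE.
(* Since [K] is a clique, a vertex of [K] isolated in [S] is the only vertex of [S :&: K], so at
   most one term of [p S] is nonzero. *)
have iso_uniq (S : {set V}) u t : u \in K -> u \in S -> t \in K -> t != u ->
    isolated_in adj S t = false.
  move=> uK uS tK tu; apply/negP => /andP[_ /forall_inP/(_ u uS)].
  by rewrite clK.
have pE1 (S : {set V}) u : u \in K -> u \in S ->
    p S = (isolated_in adj S u)%:R * (w [set v; u] / m u).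
  move=> uK uS; rewrite /p (_ : (S :&: K == set0) = false) ?mul0r ?add0r.
    rewrite (bigD1 u) //= big1 ?addr0 // => t /andP[tK tu].
    by rewrite (iso_uniq S u t) ?mul0r.
  by apply/negP => /eqP/setP/(_ u); rewrite in_setI uS uK in_set0.
apply: (@decomposes_split R V adj x w W v lam p) => //.
- move=> S _; have [/pE0 ->|/set0Pn[u]] := eqVneq (S :&: K) set0; first exact: div01.
  rewrite in_setI => /andP[uS uK]; rewrite (pE1 S u) //.
  by case: isolated_in; rewrite ?mul1r ?div01 ?hm // mul0r lexx ler01.
- move=> S lS; have /andP[coS SW] := lamS S lS.
  have SK t : t \in S -> adj v t -> t \in S :&: K.
    by move=> tS vt; rewrite !inE tS vt (subsetP SW).
  have [SK0 _|/set0Pn[u]] := eqVneq (S :&: K) set0.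
    apply: co2plexU1 => // [|t tS vt]; last by have := SK t tS vt; rewrite SK0 inE.
    rewrite (_ : [set _ in _ | _] = set0) ?cards0 //; apply/setP => t.
    rewrite !in_set; apply/negP => /andP[tS vt].
    by have := SK t tS vt; rewrite SK0 inE.
  rewrite in_setI => /andP[uS uK]; rewrite (pE1 S u) //.
  case: (boolP (isolated_in adj S u)) => [isou _|]; last by rewrite mul0r eqxx.
  have onlyu t : t \in S -> adj v t -> t = u.
    move=> tS vt; apply/eqP; apply: contraTT isou => tu.
    have := SK t tS vt; rewrite in_setI => /andP[_ tK].
    by rewrite (iso_uniq S t u) // eq_sym.
  apply: co2plexU1 => // [|t tS vt]; last by rewrite (onlyu t).
  rewrite -(cards1 u); apply: subset_leq_card; apply/subsetP => t.
  by rewrite !inE => /andP[tS vt]; rewrite (onlyu t) ?eqxx.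
- transitivity (m0 * (z / m0) + \sum_(u in K) m u * (w [set v; u] / m u)).
    rewrite {1}/m0 mulr_suml; under [X in _ = _ + X]eq_bigr do rewrite {1}/m mulr_suml.
    rewrite exchange_big -big_split; apply: eq_bigr => S _ /=.
    rewrite /p mulrDr mulrA mulr_sumr; congr (_ + _).
    by apply: eq_bigr => u _; rewrite mulrA.
  rewrite divK // (eq_bigr (fun u => w [set v; u])) => [|u uK].
    by rewrite /z subrK.
  by rewrite divK // hm.
- move=> u uW vu; have uK : u \in K by rewrite inE uW vu.
  rewrite -(divK _ _ (hm u uK)) /m mulr_suml; apply: eq_bigr => S _.
  case: (boolP (u \in S)) => uS; first by rewrite (pE1 S u) // mulr1 mulrA.
  by rewrite /isolated_in (negbTE uS) /= !mulr0 mul0r.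
Qed.

(** Induction removes a simplicial vertex of [W] and reinserts it into the decomposition of the
    rest; the base case is the unit mass at the empty set. *)
Lemma chordal_decomposes (R : realType) (V : finType) (adj : rel V) (x : V -> R)
    (w : {set V} -> R) (W : {set V}) :
  simple_graph adj -> chordal adj -> edge_feasible adj x w ->
  exists lam, decomposes_on adj x w W lam.
Proof.
move=> G chG fxw; have [n] := ubnP #|W|; elim: n W => // n IHn W Wn.
have [->|W0] := eqVneq W set0.
  exists (fun S => (S == set0)%:R); split=> [S|S||v|A eA].
  - exact: ler0n.
  - have [-> _|_] := eqVneq S set0; last by rewrite eqxx.
    by rewrite sub0set andbT; apply/forall_inP => v; rewrite inE.
  - by rewrite (bigD1 set0) //= eqxx big1 ?addr0 // => S /negbTE ->.
  - by rewrite inE.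
  - by rewrite subset0 => /eqP A0; have := card_edge G.2 eA; rewrite A0 cards0.
have [||v [vW _ sv]] := @chordal_simplicial V adj W set0 G chG.
- by move=> u t; rewrite inE.
- by rewrite properE sub0set /= subset0.
have [|lam dec] := IHn (W :\ v).
  by rewrite -ltnS; apply: leq_trans Wn; rewrite ltnS [X in (_ < X)%N](cardsD1 v) vW.
have sD : simplicial_in adj (W :\ v) v.
  move=> a b; rewrite !inE => /andP[/andP[_ aW] va] /andP[/andP[_ bW] vb].
  by apply: sv; rewrite inE ?aW ?bW.
by have := decomposes_simplicial G fxw (negbT (setD11 v W)) sD dec; rewrite setD1K.
Qed.

Lemma system_Pxy (R : realType) (V : finType) (adj : rel V) (x : V -> R)
    (y : edge adj -> R) :
  simple_graph adj -> chordal adj -> in_system x y -> in_Pxy x y.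
Proof.
move=> G chG sys.
have [lam [lam0 lamS lam1 lamx lamw]] :=
  chordal_decomposes setT G chG (system_feasible G sys).
have co_sum f : \sum_(S | co2plex adj S) lam S * f S = \sum_S lam S * f S.
  rewrite big_mkcond; apply: eq_bigr => S _; case: ifP => // nco.
  have [->|/lamS] := eqVneq (lam S) 0; first by rewrite mul0r.
  by rewrite nco.
exists lam; split=> [S _|||e] //.
- rewrite -[RHS]lam1; under eq_bigr do rewrite -[lam _]mulr1.
  by rewrite co_sum; under eq_bigr do rewrite mulr1.
- by move=> v; rewrite co_sum lamx ?inE.
- by rewrite co_sum -(extend_edgeK y) lamw ?(valP e) ?subsetT.
Qed.

(** * Holes and points outside the polytope *)

Lemma support_vanish (R : realType) (V : finType) (adj : rel V)
    (lam f : {set V} -> R) (S : {set V}) :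
  (forall T, co2plex adj T -> 0 <= lam T) -> (forall T, 0 <= f T) ->
  \sum_(T | co2plex adj T) lam T * f T = 0 ->
  co2plex adj S -> lam S != 0 -> f S = 0.
Proof.
move=> lam0 f0 /psumr_eq0P sum0 coS lS.
have /eqP := sum0 (fun T coT => mulr_ge0 (lam0 T coT) (f0 T)) S coS.
by rewrite mulf_eq0 (negbTE lS) => /eqP.
Qed.

(** In the first case the sets containing both ends have mass [y e = 0], and those containing
    neither have mass [1 - x u - x v + y e = 0]. In the second, the sets containing only [u] have
    mass [x u - y e = 0], and likewise for [v]. *)
Lemma support_edge (R : realType) (V : finType) (adj : rel V) (x : V -> R)
    (y : edge adj -> R) (lam : {set V} -> R) (e : edge adj) (u v : V)
    (S : {set V}) :
  (forall T, co2plex adj T -> 0 <= lam T) ->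
  \sum_(T | co2plex adj T) lam T = 1 ->
  (forall t, x t = \sum_(T | co2plex adj T) lam T * chiv R T t) ->
  (forall f, y f = \sum_(T | co2plex adj T) lam T * zetav R T f) ->
  val e = [set u; v] -> co2plex adj S -> lam S != 0 ->
  (y e = 0 -> x u + x v = 1 -> (u \in S) = ~~ (v \in S)) /\
  (y e = x u -> y e = x v -> (u \in S) = (v \in S)).
Proof.
move=> lam0 lam1 xE yE eE coS lS.
have vanish (f : {set V} -> R) : (forall T, 0 <= f T) ->
    \sum_(T | co2plex adj T) lam T * f T = 0 -> f S = 0.
  by move=> f0 sum0; exact: (support_vanish lam0 f0 sum0).
have zE T : zetav R T e = ((u \in T) && (v \in T))%:R.
  by rewrite /zetav eE subUset !sub1set.
have nat0 (b : bool) : b%:R = 0 :> R -> b = false by move/eqP; rewrite pnatr_eq0; case: b.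
split=> [ye0 xuv|yu yv].
  have uv1 : (u \in S) && (v \in S) = false.
    apply: nat0.
    apply: (vanish (fun T => ((u \in T) && (v \in T))%:R) (fun T => ler0n _ _)).
    by rewrite -[RHS]ye0 yE; apply: eq_bigr => T _; rewrite zE.
  have := vanish (fun T => (~~ (u \in T) && ~~ (v \in T))%:R) (fun T => ler0n _ _).
  have -> : \sum_(T | co2plex adj T) lam T * (~~ (u \in T) && ~~ (v \in T))%:R = 0.
    transitivity (1 - (x u + x v) + y e); last by rewrite xuv ye0; lra.
    rewrite -[X in X - _]lam1 !xE yE -big_split -sumrB -big_split /=.
    apply: eq_bigr => T _; rewrite zE /chiv.
    by case: (u \in T); case: (v \in T) => /=; ring.
  move=> /(_ erefl) /nat0; move: uv1.
  by case: (u \in S); case: (v \in S).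
have half (a b : V) : y e = x a ->
    (forall T, zetav R T e = ((a \in T) && (b \in T))%:R) -> (a \in S) && ~~ (b \in S) = false.
  move=> ya zab; apply: nat0.
  apply: (vanish (fun T => ((a \in T) && ~~ (b \in T))%:R) (fun T => ler0n _ _)).
  transitivity (x a - y e); last by rewrite ya subrr.
  rewrite xE yE -sumrB; apply: eq_bigr => T _; rewrite zab /chiv.
  by case: (a \in T); case: (b \in T) => /=; ring.
have := half u v yu zE.
have := half v u yv (fun T => etrans (zE T) (congr1 _ (congr1 _ (andbC _ _)))).
by case: (u \in S); case: (v \in S).
Qed.

Lemma clique_meets_hole (V : finType) (adj : rel V) (k : nat) (c : 'I_k -> V)
    (K : {set V}) :
  is_hole adj c -> is_clique adj K -> (#|K :&: [set c i | i : 'I_k]| <= 2)%N.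
Proof.
move=> [k4 cinj cadj] clK; rewrite leqNgt; apply/negP => /card_gt2P.
move=> [a [b [d [[]]]]]; rewrite !in_setI.
move=> /andP[aK /imsetP[i _ ai]] /andP[bK /imsetP[j _ bj]] /andP[dK /imsetP[l _ dl]].
move=> [ab bd da].
have := clK a b aK bK ab; have := clK b d bK dK bd; have := clK d a dK aK da.
move: ab bd da; rewrite ai bj dl !cadj !(inj_eq cinj) -!val_eqE /=.
rewrite !modn_succ //.
have := ltn_ord i; have := ltn_ord j; have := ltn_ord l.
clear ai bj dl.
move: (nat_of_ord i) (nat_of_ord j) (nat_of_ord l) => {}i {}j {}l.
by do 3 case: ifP => ?; lia.
Qed.

(* On a hole take [x = 1/2] everywhere, and [y = 1/2] on a single edge of the hole
   if its length is even, [y = 0] otherwise.  A set in a convex decomposition of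
   this point contains exactly one end of each hole edge with [y = 0] and both or
   neither end of the exceptional edge, which is impossible by parity. *)
Lemma hole_separates (R : realType) (V : finType) (adj : rel V) (k : nat)
    (c : 'I_k -> V) :
  simple_graph adj -> is_hole adj c ->
  exists (x : V -> R) (y : edge adj -> R), in_system x y /\ ~ in_Pxy x y.
Proof.
move=> G hole; have [k4 _ _] := hole.
case: k c hole k4 => // n c hole n3; have [_ cinj cadj] := hole.
have n1 : (1 <= n)%N by lia.
have n2 : (2 <= n)%N by lia.
pose g i := c (inord i).
have gadj i j : (i <= n)%N -> (j <= n)%N -> adj (g i) (g j) =
    (j == if i == n then 0%N else i.+1) || (i == if j == n then 0%N else j.+1).
  by move=> iN jN; rewrite cadj !inordK // !modn_succ // !eqSS.
have g_eq i j : (i <= n)%N -> (j <= n)%N -> (g i == g j) = (i == j).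
  by move=> iN jN; rewrite (inj_eq cinj) -val_eqE /= !inordK.
pose H := [set c i | i : 'I_n.+1].
have gH i : g i \in H by apply: imset_f.
pose e0 := [set g 0%N; g 1%N].
(* The hole has [n.+1] vertices, so [b] says that its length is even. *)
pose b := odd n.
pose x v : R := (v \in H)%:R / 2.
pose Y A : R := (b && (A == e0))%:R / 2.
pose y (e : edge adj) : R := Y (val e).
have Y0 A : 0 <= Y A by rewrite divr_ge0.
have adj01 : adj (g 0%N) (g 1%N) by rewrite gadj // (ltn_eqF n1).
have e0_edge : is_edge adj e0 by apply/is_edgeP; exists (g 0%N), (g 1%N).
exists x, y; split.
  split=> [v|e|K [clK _]].
  - rewrite (sum_edge_type adj (fun A => v \in A) Y).
    case: (boolP (v \in e0)) => ve0.
      rewrite (bigD1 e0) ?e0_edge //= big1 => [|A /andP[_ /negbTE Ae0]].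
        have vH : v \in H by move: ve0; rewrite !inE => /orP[]/eqP ->; apply: gH.
        rewrite addr0 /x vH /Y eqxx andbT ler_pM2r ?invr_gt0 ?ltr0n //.
        by rewrite ler_nat leq_b1.
      by rewrite /Y Ae0 andbF mul0r.
    rewrite big1 ?divr_ge0 // => A /andP[_ vA]; rewrite /Y.
    case: eqP => [Ae0|_]; last by rewrite andbF mul0r.
    by rewrite Ae0 (negbTE ve0) in vA.
  - by rewrite oppr_le0; apply: Y0.
  - apply: (@le_trans _ _ (\sum_(v in K) x v)).
      by rewrite gerBl; apply: sumr_ge0 => e _; apply: Y0.
    rewrite /x -mulr_suml ler_pdivrMr ?ltr0n // mul1r.
    rewrite (_ : \sum_(v in K) _ = #|K :&: H|%:R).
      by rewrite ler_nat; apply: clique_meets_hole.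
    rewrite -sum1_card natr_sum big_mkcond [RHS]big_mkcond /=.
    apply: eq_bigr => u _; rewrite in_setI.
    by case: (u \in K); case: (u \in H).
move=> [lam [lam0 lam1 xE yE]].
have [S coS lS] : exists2 S, co2plex adj S & lam S != 0.
  apply/exists_inP; apply: contraT; rewrite negb_exists => /forallP lam_eq0.
  move: lam1; rewrite big1 => [/eqP|S coS]; first by rewrite eq_sym oner_eq0.
  by have := lam_eq0 S; rewrite coS /= negbK => /eqP.
have xg i : x (g i) = 1 / 2 by rewrite /x gH.
have flip i j : (i <= n)%N -> (j <= n)%N -> adj (g i) (g j) ->
    Y [set g i; g j] = 0 -> (g i \in S) = ~~ (g j \in S).
  move=> iN jN gij Yij.
  have eij : is_edge adj [set g i; g j] by apply/is_edgeP; exists (g i), (g j).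
  have [h _] := support_edge (e := Sub _ eij) lam0 lam1 xE yE erefl coS lS.
  by apply: h; rewrite ?/y //= !xg; lra.
(* Every hole edge other than [e0] has an end of index at least 2. *)
have Yn i j : (2 <= j <= n)%N -> Y [set g i; g j] = 0.
  move=> jn; rewrite /Y (_ : _ == e0 = false) ?andbF ?mul0r //.
  apply/negP => /eqP/setP/(_ (g j)); rewrite !inE eqxx orbT !g_eq; lia.
have alt i : (i < n)%N -> (g i.+1 \in S) = (g 1%N \in S) (+) odd i.
  elim: i => [|i IHi] iN; first by rewrite addbF.
  have := flip i.+1 i.+2 (ltnW iN) iN.
  rewrite gadj ?(ltnW iN) // (ltn_eqF iN) eqxx => /(_ isT).
  rewrite Yn // => /(_ erefl); rewrite IHi ?(ltnW iN) //=.
  by case: (g i.+2 \in S); case: (g 1%N \in S); case: (odd i).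
have last_flip : (g 0%N \in S) = ~~ (g n \in S).
  apply: flip => //; last by rewrite Yn // n2 leqnn.
  by rewrite gadj // eqxx orbT.
(* Going round the hole the long way, from [g 1] through [g n] to [g 0], flips membership [n] times;
   both cases below contradict what [e0] requires. *)
have g0 : (g 0%N \in S) = (g 1%N \in S) (+) b.
  have := alt n.-1; rewrite prednK // => /(_ (leqnn _)) gn.
  rewrite last_flip gn /b -{2}(prednK n1) /=.
  by case: (g 1%N \in S); case: (odd _).
case: (boolP b) => bT.
  have [_ h] := support_edge (e := Sub _ e0_edge) lam0 lam1 xE yE erefl coS lS.
  have : (g 0%N \in S) = (g 1%N \in S).
    by apply: h; rewrite xg /y /= /Y bT eqxx.
  by rewrite g0 bT; case: (g 1%N \in S).
have : (g 0%N \in S) = ~~ (g 1%N \in S).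
  by apply: flip => //; rewrite /Y (negbTE bT) mul0r.
by rewrite g0 (negbTE bT) addbF; case: (g 1%N \in S).
Qed.

Theorem mainTheorem4 (R : realType) (V : finType) (adj : rel V) :
  simple_graph adj -> graph_connected adj ->
  (chordal adj <->
   (forall (x : V -> R) (y : edge adj -> R), in_Pxy x y <-> in_system x y)).
Proof.
move=> G _; split=> [chG x y|PE].
  by split; [exact: Pxy_system | exact: system_Pxy].
move=> [k [c hole]]; have [x [y [sys nP]]] := hole_separates R G hole.
by apply: nP; apply/PE.
Qed.
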